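(* Let $(K,\Delta)$ be a Hermitian form field, let $n\geq 3$ and $G=U_{2n+1}(K,\Delta)$. Let $\mathcal{C}$ denote the set of all conjugacy classes of $G$ of level $(K,\Delta)$ and let $S_{\mathrm{short}}$ denote the set of all nontrivial short root transvections in $G$. Then $\mathrm{scn}_{\mathcal{C}}(S_{\mathrm{short}})\leq 4$.
   Context: Hermitian form fields. A Hermitian form field $(K,\Delta)$ consists of the following data. $K$ is a (commutative) field with a ring automorphism $x\mapsto\bar x$, an element $\lambda\in K$ with $\bar{\bar x}=\lambda x\bar\lambda$ for all $x\in K$ (hence $\bar\lambda=\lambda^{-1}$), and an element $\mu\in K$ with $\mu=\bar\mu\lambda$. The Heisenberg group $\mathfrak{H}$ is the set $K\times K$ with group operation $(x_1,y_1)\dot{+}(x_2,y_2)=(x_1+x_2,\,y_1+y_2-\bar x_1\mu x_2)$; the inverse of $(x,y)$ is $\dot{-}(x,y)=(-x,-y-\bar x\mu x)$, and $a\dot{-}b$ means $a\dot{+}(\dot{-}b)$. For $a\in K$ put $(x,y)\circ a=(xa,\bar a y a)$. A subgroup of $\mathfrak{H}$ stable under $\circ a$ for all $a\in K$ is called a $K^\bullet$-submodule. For $A\subseteq\mathfrak H$, $B\subseteq K$, $A\circ B$ denotes the subgroup of $\mathfrak H$ generated by all $a\circ b$, $a\in A,b\in B$. Put $\mathrm{tr}(x,y)=\bar x\mu x+y+\bar y\lambda$, $\Delta_{\min}=\{(0,x-\bar x\lambda)\mid x\in K\}$ and $\Delta_{\max}=\{(x,y)\in\mathfrak H\mid \mathrm{tr}(x,y)=0\}$.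 $\Delta$ is a $K^\bullet$-submodule of $\mathfrak H$ with $\Delta_{\min}\subseteq\Delta\subseteq\Delta_{\max}$. Odd form ideals. Put $J(\Delta)=\{y\in K\mid \exists z\in K: (y,z)\in\Delta\}$. For an ideal $I$ of $K$ with $\bar x\in I$ for all $x\in I$, put $\tilde I=\{x\in K\mid \overline{J(\Delta)}\mu x\subseteq I\}$, $\Omega^I_{\min}=\{(0,x-\bar x\lambda)\mid x\in I\}\dot{+}\Delta\circ I$ and $\Omega^I_{\max}=\Delta\cap(\tilde I\times I)$. An odd form ideal of $(K,\Delta)$ is a pair $(I,\Omega)$ where $I$ is an ideal of $K$ with $\bar x\in I$ for all $x\in I$ and $\Omega$ is a $K^\bullet$-submodule of $\mathfrak H$ with $\Omega^I_{\min}\subseteq\Omega\subseteq\Omega^I_{\max}$. The unitary group. Let $M=K^{2n+1}$ (column vectors) with standard basis indexed $(e_1,\dots,e_n,e_0,e_{-n},\dots,e_{-1})$; rows and columns of $(2n+1)\times(2n+1)$ matrices are indexed in the same way. Define $B(u,v)=\sum_{i=1}^n\bar u_iv_{-i}+\bar u_0\mu v_0+\sum_{i=-n}^{-1}\bar u_i\lambda v_{-i}$ and $Q(u)=(u_0,\sum_{i=1}^n\bar u_iu_{-i})\in\mathfrak H$. Then $U_{2n+1}(K,\Delta)$ is the group of all $\sigma\in GL_{2n+1}(K)$ with $B(\sigma u,\sigma v)=B(u,v)$ and $Q(\sigma u)\dot{-}Q(u)\in\Delta$ for all $u,v\in M$. Transvections. Let $\Theta_{\mathrm{hb}}=\{\pm1,\dots,\pm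 n\}$, $\epsilon(i)=1$ if $i>0$ and $\epsilon(i)=-1$ if $i<0$. Let $e$ be the identity matrix and $e^{ij}$ the matrix units. Short root transvections are the matrices $T_{ij}(x)=e+xe^{ij}-\lambda^{(\epsilon(j)-1)/2}\bar x\lambda^{(1-\epsilon(i))/2}e^{-j,-i}$ with $i,j\in\Theta_{\mathrm{hb}}$, $i\neq\pm j$, $x\in K$. For a subset $\Omega\subseteq K\times K$ put $\Omega^{1}=\Omega$ and $\Omega^{-1}=\{(x,y)\mid (x,\bar y)\in\Omega\}$. Extra short root transvections are the matrices $T_i(x,y)=e+xe^{0,-i}-\lambda^{-(1+\epsilon(i))/2}\bar x\mu e^{i0}+ye^{i,-i}$ with $i\in\Theta_{\mathrm{hb}}$, $(x,y)\in\Delta^{-\epsilon(i)}$. All these lie in $U_{2n+1}(K,\Delta)$; nontrivial means different from $e$. $E=EU_{2n+1}(K,\Delta)$ is the subgroup generated by all short and extra short root transvections. Relative subgroups. Let $(I,\Omega)$ be an odd form ideal. $T_{ij}(x)$ is $(I,\Omega)$-elementary if $x\in I$; $T_i(x,y)$ is $(I,\Omega)$-elementary if $(x,y)\in\Omega^{-\epsilon(i)}$. $EU_{2n+1}((K,\Delta),(I,\Omega))$ is the normal closure in $E$ of the subgroup generated by all $(I,\Omega)$-elementary transvections. $U_{2n+1}((K,\Delta),(I,\Omega))$ is the subgroup of all $\sigma\in U_{2n+1}(K,\Delta)$ with $\sigma_{ij}-\delta_{ij}\in I$ for all $i,j\in\Theta_{\mathrm{hb}}$ and $Q(\sigma u)\dot{-}Q(u)\in\Omega$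 for all $u\in M$ with $u_0\in J(\Delta)$. $NU_{2n+1}((K,\Delta),(I,\Omega))$ is its normaliser in $U_{2n+1}(K,\Delta)$, and $CU_{2n+1}((K,\Delta),(I,\Omega))=\{\sigma\in NU_{2n+1}((K,\Delta),(I,\Omega))\mid [\sigma,E]\leq U_{2n+1}((K,\Delta),(I,\Omega))\}$. Level. Let $n\geq3$. It is known (Bak–Preusser) that for every subgroup $H$ of $U_{2n+1}(K,\Delta)$ normalised by $E$ there is a unique odd form ideal $(I,\Omega)$ with $EU_{2n+1}((K,\Delta),(I,\Omega))\subseteq H\subseteq CU_{2n+1}((K,\Delta),(I,\Omega))$; it is called the level of $H$. The level of a conjugacy class $C$ of $G=U_{2n+1}(K,\Delta)$ is the level of the subgroup generated by $C$. Covering numbers. For a group $G$ and subsets $S,X\subseteq G$, $\mathrm{cn}_X(S)$ is the least positive integer $m$ with $S\subseteq X^m=\{x_1\cdots x_m\mid x_i\in X\}$ ($\infty$ if there is none), and $\mathrm{scn}_X(S)=\mathrm{cn}_{X\cup X^{-1}}(S)$. For a set $\mathcal X$ of subsets of $G$, $\mathrm{scn}_{\mathcal X}(S)=\sup\{\mathrm{scn}_X(S)\mid X\in\mathcal X\}$. *)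

(* Defs.v *)
From mathcomp Require Import all_boot all_order all_algebra.
From mathcomp Require Import boolp classical_sets constructive_ereal.

Set Implicit Arguments.
Unset Strict Implicit.
Unset Printing Implicit Defensive.

Import Order.TTheory GRing.Theory Num.Theory.
Local Open Scope classical_set_scope.
Local Open Scope ring_scope.

Section Subgroups.
Context {T : Type} (op : T -> T -> T) (one : T) (inv : T -> T).

Definition is_subgroup (H : set T) : Prop :=
  [/\ H one, forall a b, H a -> H b -> H (op a b) & forall a, H a -> H (inv a)].

Definition generated (A : set T) : set T := smallest is_subgroup A.

End Subgroups.

(* Linear groups are sets of units of a unit ring (here, a matrix ring); the
   total inverse of the ring is only ever applied to units. *)
Section UnitGroups.
Context {R : unitRingType}.
Implicit Types (G H E A X S : set R) (g h : R).

Definition msubgroup : set R -> Prop := is_subgroup *%R 1 (@GRing.inv R).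

Definition mgenerated : set R -> set R := generated *%R 1 (@GRing.inv R).

Definition conjugate g h : R := g * h * g^-1.

Definition commutator g h : R := g * h * g^-1 * h^-1.

Definition normal_closure E A : set R :=
  smallest (fun H => msubgroup H /\
                     forall g h, E g -> H h -> H (conjugate g h)) A.

Definition normaliser G H : set R :=
  [set g | G g /\ conjugate g @` H = H].

Definition conjugacy_class G h : set R := [set conjugate g h | g in G].

Definition set_power X (m : nat) : set R :=
  [set \prod_(i < m) x i | x in [set x : 'I_m -> R | forall i, X (x i)]].

(* Covering numbers take their values in the positive integers together with
   infinity, embedded in [\bar int]; a nonempty set of positive integers
   attains its infimum, and the infimum of the empty set is [+oo]. *)
Definition cn X S : \bar int :=
  infimum +oo%E
    [set (m%:Z)%:E | m in [set m : nat | (0 < m)%N /\ S `<=` set_power X m]].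

Definition scn X S : \bar int := cn (X `|` [set x^-1 | x in X]) S.

(* Every subset of the extended natural numbers has a supremum; that of the
   empty set is [0]. *)
Definition scn_family (XX : set (set R)) S : \bar int :=
  supremum 0%E [set scn X S | X in XX].

End UnitGroups.

Record hermitianForm (K : fieldType) := HermitianForm {
  bar : {rmorphism K -> K};
  bar_bij : bijective bar;
  lam : K;
  barbar : forall x, bar (bar x) = lam * x * bar lam;
  mu : K;
  mu_bar : mu = bar mu * lam }.

Section Heisenberg.
Context {K : fieldType} (h : hermitianForm K).
Notation bar := (bar h).
Notation lam := (lam h).
Notation mu := (mu h).

Definition hadd (a b : K * K) : K * K :=
  (a.1 + b.1, a.2 + b.2 - bar a.1 * mu * b.1).

Definition hopp (a : K * K) : K * K := (- a.1, - a.2 - bar a.1 * mu * a.1).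

Definition hsub (a b : K * K) : K * K := hadd a (hopp b).

Definition hact (a : K * K) (c : K) : K * K := (a.1 * c, bar c * a.2 * c).

Definition hsubgroup : set (K * K) -> Prop := is_subgroup hadd 0 hopp.

Definition Ksubmodule (A : set (K * K)) : Prop :=
  hsubgroup A /\ forall a c, A a -> A (hact a c).

Definition hact_set (A : set (K * K)) (B : set K) : set (K * K) :=
  generated hadd 0 hopp [set hact a b | a in A & b in B].

Definition htr (a : K * K) : K := bar a.1 * mu * a.1 + a.2 + bar a.2 * lam.

Definition skew_part (I : set K) : set (K * K) :=
  [set (0, x - bar x * lam) | x in I].

Definition Delta_min : set (K * K) := skew_part setT.

Definition Delta_max : set (K * K) := [set a | htr a = 0].

End Heisenberg.

Record hermitianFormField (K : fieldType) := HermitianFormField {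
  hform :> hermitianForm K;
  Delta : set (K * K);
  Delta_submod : Ksubmodule hform Delta;
  Delta_minP : Delta_min hform `<=` Delta;
  Delta_maxP : Delta `<=` Delta_max hform }.

Section OddFormIdeals.
Context {K : fieldType} (F : hermitianFormField K).

Definition Jset : set K := [set y | exists z, Delta F (y, z)].

Definition is_ideal (I : set K) : Prop :=
  [/\ I 0, forall x y, I x -> I y -> I (x + y) & forall a x, I x -> I (a * x)].

Definition tilde (I : set K) : set K :=
  [set x | forall a, Jset a -> I (bar F a * mu F * x)].

Definition Omega_min (I : set K) : set (K * K) :=
  [set hadd F a b | a in skew_part F I & b in hact_set F (Delta F) I].

Definition Omega_max (I : set K) : set (K * K) :=
  Delta F `&` (tilde I `*` I).

Definition odd_form_ideal (I : set K) (Omega : set (K * K)) : Prop :=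
  [/\ is_ideal I, forall x, I x -> I (bar F x), Ksubmodule F Omega,
      Omega_min I `<=` Omega & Omega `<=` Omega_max I].

End OddFormIdeals.

(* The 2n+1 rows and columns, labelled 1, ..., n, 0, -n, ..., -1 in this order,
   are the elements 0, ..., 2n of ['I_(2 * n).+1]: the label 0 is at position
   n, the positive labels come before it, the negative ones after it, and
   [rev_ord] is the negation of labels. *)
Section Indices.
Context {n : nat}.
Implicit Types i : 'I_(2 * n).+1.

Definition mid : 'I_(2 * n).+1 := inord n.

Definition hb i : bool := i != mid.

Definition epsilon i : int := if (i < n)%N then 1 else - 1.

End Indices.

Section UnitaryGroup.
Context {K : fieldType} (F : hermitianFormField K) (n : nat).
Notation bar := (bar F).
Notation lam := (lam F).
Notation mu := (mu F).
Notation M := 'cV[K]_((2 * n).+1).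
Notation mat := 'M[K]_((2 * n).+1).
Notation idx := 'I_(2 * n).+1.

Definition Bform (u v : M) : K :=
  \sum_(i : idx | (i < n)%N) bar (u i 0) * v (rev_ord i) 0
  + bar (u mid 0) * mu * v mid 0
  + \sum_(i : idx | (n < i)%N) bar (u i 0) * lam * v (rev_ord i) 0.

Definition Qform (u : M) : K * K :=
  (u mid 0, \sum_(i : idx | (i < n)%N) bar (u i 0) * u (rev_ord i) 0).

Definition unitary_group : set mat :=
  [set s | [/\ s \in unitmx,
               forall u v, Bform (s *m u) (s *m v) = Bform u v
             & forall u, Delta F (hsub F (Qform (s *m u)) (Qform u))]].

(* The integer divisions in the exponents of [lam] below are exact. *)
Definition Tshort (i j : idx) (x : K) : mat :=
  1%:M + x *: delta_mx i j
  - (lam ^ ((epsilon j - 1) %/ 2)%Z * bar x * lam ^ ((1 - epsilon i) %/ 2)%Z)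
      *: delta_mx (rev_ord j) (rev_ord i).

(* Omega^e, for a sign e. *)
Definition signed_part (Omega : set (K * K)) (e : int) : set (K * K) :=
  if e == 1 then Omega else [set a | Omega (a.1, bar a.2)].

Definition Textra (i : idx) (a : K * K) : mat :=
  1%:M + a.1 *: delta_mx mid (rev_ord i)
  - (lam ^ (- ((1 + epsilon i) %/ 2)%Z) * bar a.1 * mu) *: delta_mx i mid
  + a.2 *: delta_mx i (rev_ord i).

Definition elementary (I : set K) (Omega : set (K * K)) : set mat :=
  [set s | exists i j x,
     [/\ hb i, hb j, i != j, i != rev_ord j & I x /\ s = Tshort i j x]]
  `|`
  [set s | exists i a,
     [/\ hb i, signed_part Omega (- epsilon i) a & s = Textra i a]].

Definition EU : set mat := mgenerated (elementary setT (Delta F)).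

Definition EU_rel (I : set K) (Omega : set (K * K)) : set mat :=
  normal_closure EU (mgenerated (elementary I Omega)).

Definition U_rel (I : set K) (Omega : set (K * K)) : set mat :=
  [set s | [/\ unitary_group s,
               forall i j, hb i -> hb j -> I (s i j - (i == j)%:R)
             & forall u : M, Jset F (u mid 0) ->
                 Omega (hsub F (Qform (s *m u)) (Qform u))]].

Definition NU_rel (I : set K) (Omega : set (K * K)) : set mat :=
  normaliser unitary_group (U_rel I Omega).

Definition CU_rel (I : set K) (Omega : set (K * K)) : set mat :=
  [set s | NU_rel I Omega s /\
           mgenerated [set commutator s t | t in EU] `<=` U_rel I Omega].

(* For n >= 3, a subgroup normalised by EU has exactly one level
   (Bak, Preusser). *)
Definition is_level (H : set mat) (I : set K) (Omega : set (K * K)) : Prop :=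
  [/\ odd_form_ideal F I Omega, EU_rel I Omega `<=` H & H `<=` CU_rel I Omega].

Definition classes_of_level (I : set K) (Omega : set (K * K)) :
    set (set mat) :=
  [set C | (exists2 s, unitary_group s & C = conjugacy_class unitary_group s)
           /\ is_level (mgenerated C) I Omega].

Definition nontrivial_short : set mat :=
  [set s | s <> 1%:M /\
     exists i j x, [/\ hb i, hb j, i != j, i != rev_ord j & s = Tshort i j x]].

End UnitaryGroup.

Arguments unitary_group {K} F n _.
Arguments EU {K} F n _.
Arguments EU_rel {K} F n I Omega _.
Arguments U_rel {K} F n I Omega _.
Arguments NU_rel {K} F n I Omega _.
Arguments CU_rel {K} F n I Omega _.
Arguments is_level {K} F {n} H I Omega.
Arguments classes_of_level {K} F n I Omega _.
Arguments nontrivial_short {K} F n _.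

(* Main.v *)
Require Import Defs.
From mathcomp Require Import all_boot all_order all_algebra.
From mathcomp Require Import boolp classical_sets constructive_ereal.
From mathcomp Require Import ring zify.

(** Write B for the sesquilinear form, Q for the map into the Heisenberg group,
    rad for the radical of B, and call u isotropic when Q(u) lies in Delta; the
    group G permutes the isotropic vectors.  For orthogonal isotropic vectors
    f and w, the Siegel transformation
      S(f, w) : x |-> x + B(f, x) w - lam^-1 B(w, x) f
    lies in G, and g S(f, w) g^-1 = S(g f, g w) for g in G.  Every nontrivial
    short root transvection is an S(f, w) with f and w independent modulo rad.
    All these S(f, w) are conjugate in G [siegel_pair_conj], because G acts
    transitively on the pairs (f, w) in question: a generalized Siegel
    transformation carries u to v as soon as an isotropic vector has the same
    nonzero product with both [siegel_transport], and this connects every pair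
    to a pair of basis vectors.

    So it is enough to write one S(f, w) as a product of four conjugates of
    elements of C and of their inverses, and a double commutator
      [[s, a], b] = s . (a s^-1 a^-1) . (ba s (ba)^-1) . (b s^-1 b^-1)
    with s in C has this form.  Let P = <u, v> be a totally isotropic plane with
    s P not orthogonal to P.  One can choose u, v and t in P such that
    B(t, s u) = 0 and B(t, s v) <> 0.  For a = S(v, u), the commutator
    [s, a] = S(s v, s u) S(v, -u) sends t to t + c (s u) with c <> 0, and fixes
    every vector orthogonal to P + s P.  If r is isotropic, orthogonal to
    P + s P and independent of s u modulo rad, then for b = S(r, t)
      [[s, a], b] = S(r, t + c (s u)) S(r, -t) = S(r, c (s u)).
    For n >= 3 such an r exists [double_commutator]: P lies in a totally isotropic
    space of dimension 3 spanned by basis vectors, in which orthogonality to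
    s u and s v amounts to two linear equations.

    It remains to find s and P.  Let p be the first label.  If every element of
    C maps e_p into K e_p + rad, then so do all products of these elements and
    their inverses, since C is closed under conjugation; but the level of C
    being (K, Delta) makes T_qp(1), which sends e_p to e_p + e_q, one of these
    products [class_moves_line].  So some s in C moves the line of e_p modulo
    rad.  As s e_p is isotropic, it then has a nonzero coordinate at a label
    j <> p, j <> 0, that is, s e_p is not orthogonal to e_-j, and P can be
    spanned by two basis vectors: e_p and e_-j if j <> -p, and e_p together with
    any other e_q, q <> -p, if j = -p. *)

Set Implicit Arguments.
Unset Strict Implicit.
Unset Printing Implicit Defensive.

Import Order.TTheory GRing.Theory Num.Theory.
Local Open Scope classical_set_scope.
Local Open Scope ring_scope.

(** * The Heisenberg group and the set Delta *)

Section Heisenberg.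
Context {K : fieldType} (F : hermitianFormField K).
Local Notation bar := (bar F).
Local Notation lam := (lam F).
Local Notation mu := (mu F).
Implicit Types (x y z : K) (a b c : K * K).

Lemma lam_bar : lam * bar lam = 1.
Proof. by have := barbar F 1; rewrite !rmorph1 mulr1 => <-. Qed.

Lemma barK : involutive bar.
Proof. by move=> x; rewrite barbar mulrAC lam_bar mul1r. Qed.

Lemma mu_barE : bar mu * lam = mu.
Proof. by rewrite -mu_bar. Qed.

Lemma lam_neq0 : lam != 0.
Proof.
apply/eqP => l0; move: lam_bar; rewrite l0 mul0r => /esym/eqP.
by rewrite oner_eq0.
Qed.

Lemma bar_lamV : bar lam = lam^-1.
Proof. by apply: (mulfI lam_neq0); rewrite lam_bar mulfV ?lam_neq0. Qed.

Lemma bar_eq0 x : (bar x == 0) = (x == 0).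
Proof. exact: fmorph_eq0. Qed.

Lemma Delta_add a b : Delta F a -> Delta F b -> Delta F (hadd F a b).
Proof. by have [[_ + _] _] := Delta_submod F; apply. Qed.

Lemma Delta_opp a : Delta F a -> Delta F (hopp F a).
Proof. by have [[_ _ +] _] := Delta_submod F; apply. Qed.

Lemma Delta_act a x : Delta F a -> Delta F (hact F a x).
Proof. by have [_ +] := Delta_submod F; apply. Qed.

Lemma Delta_skew z : Delta F (0, z - bar z * lam).
Proof. by apply: Delta_minP; exists z. Qed.

(** Membership in Delta is insensitive to Delta_min, which lies in the centre of
    the Heisenberg group. *)
Lemma Delta_shift a z :
  Delta F a -> Delta F (a.1, a.2 + (z - bar z * lam)).
Proof.
move=> /Delta_add/(_ (Delta_skew z)); congr Delta.
by rewrite /hadd /= addr0 mulr0 subr0.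
Qed.

Lemma hopp_hsub a b : hopp F (hsub F a b) = hsub F b a.
Proof.
by rewrite /hsub /hopp /hadd /=; congr (_, _); ring.
Qed.

Lemma hsub_trans b a c :
  hsub F a c = hadd F (hsub F a b) (hsub F b c).
Proof.
by rewrite /hsub /hopp /hadd /=; congr (_, _); ring.
Qed.

Lemma htr_center a z : htr F (hadd F a (0, z)) = htr F a + z + bar z * lam.
Proof. by case: a => a1 a2; rewrite /htr /hadd /= mulr0 rmorphD addr0; ring. Qed.

End Heisenberg.

(** * The form B, the map Q and isotropic vectors *)

Section Form.
Context {K : fieldType} (F : hermitianFormField K) {n : nat}.
Local Notation bar := (bar F).
Local Notation lam := (lam F).
Local Notation mu := (mu F).
Local Notation idx := 'I_(2 * n).+1.
Local Notation M := 'cV[K]_((2 * n).+1).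
Local Notation mat := 'M[K]_((2 * n).+1).
Local Notation B := (Bform F).
Local Notation Q := (Qform F).
Implicit Types (u v w x : M) (i j k : idx) (g s : mat).

(** The entries of the antidiagonal Gram matrix of B; one formula then covers
    the three sums that define B. *)
Definition form_coef i : K := if (i < n)%N then 1 else if (n < i)%N then lam else mu.

Lemma midE : (mid : idx) = n :> nat.
Proof. by rewrite inordK //; lia. Qed.

Lemma eq_mid i : (i == mid) = (i == n :> nat).
Proof. by rewrite -val_eqE /= midE. Qed.

Lemma rev_mid : rev_ord mid = mid :> idx.
Proof. by apply: val_inj => /=; rewrite midE; lia. Qed.

Lemma hb_neq i : hb i = (i != n :> nat).
Proof. by rewrite /hb eq_mid. Qed.

Lemma BformE u v : B u v = \sum_i bar (u i 0) * form_coef i * v (rev_ord i) 0.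
Proof.
rewrite /Bform [RHS](bigID (fun i : idx => (i < n)%N)) /=.
rewrite -addrA; congr (_ + _).
  by apply: eq_bigr => i lt_in; rewrite /form_coef lt_in mulr1.
rewrite [RHS](bigD1 mid) /=; last by rewrite midE ltnn.
congr (_ + _); first by rewrite rev_mid /form_coef midE ltnn.
apply: eq_big => i; first by rewrite eq_mid; lia.
by move=> lt_ni; rewrite /form_coef lt_ni; have -> : (i < n)%N = false by lia.
Qed.

Lemma bar_coef i : bar (form_coef i) * lam = form_coef (rev_ord i).
Proof.
have rev_lt : (rev_ord i < n)%N = (n < i)%N by have := ltn_ord i; rewrite /=; lia.
have rev_gt : (n < rev_ord i)%N = (i < n)%N by have := ltn_ord i; rewrite /=; lia.
rewrite /form_coef rev_lt rev_gt; case: (ltngtP i n) => _.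
- by rewrite rmorph1 mul1r.
- by rewrite mulrC lam_bar.
- by rewrite mu_barE.
Qed.

Lemma coef_hb i : hb i -> form_coef i != 0.
Proof.
by rewrite hb_neq /form_coef; case: ltngtP => // *; rewrite ?oner_neq0 ?lam_neq0.
Qed.

Lemma BformDl u v w : B (u + v) w = B u w + B v w.
Proof.
by rewrite !BformE -big_split; apply: eq_bigr => i _ /=; rewrite !mxE; ring.
Qed.

Lemma BformDr u v w : B u (v + w) = B u v + B u w.
Proof.
by rewrite !BformE -big_split; apply: eq_bigr => i _ /=; rewrite !mxE; ring.
Qed.

Lemma BformZl c u v : B (c *: u) v = bar c * B u v.
Proof.
by rewrite !BformE big_distrr; apply: eq_bigr => i _ /=; rewrite !mxE; ring.
Qed.

Lemma BformZr c u v : B u (c *: v) = c * B u v.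
Proof.
by rewrite !BformE big_distrr; apply: eq_bigr => i _ /=; rewrite !mxE; ring.
Qed.

Lemma BformNl u v : B (- u) v = - B u v.
Proof. by rewrite -scaleN1r BformZl rmorphN1 mulN1r. Qed.

Lemma BformNr u v : B u (- v) = - B u v.
Proof. by rewrite -scaleN1r BformZr mulN1r. Qed.

Definition BformP := (BformDl, BformDr, BformZl, BformZr, BformNl, BformNr).

Lemma Bform_sym u v : B v u = bar (B u v) * lam.
Proof.
rewrite !BformE rmorph_sum big_distrl /= (reindex_inj rev_ord_inj) /=.
apply: eq_bigr => i _; rewrite rev_ordK -bar_coef !rmorphM barK; ring.
Qed.

Lemma Bform_orth u v : B u v = 0 -> B v u = 0.
Proof. by rewrite (Bform_sym u v) => ->; rewrite rmorph0 mul0r. Qed.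

Definition evec i : M := delta_mx i 0.

Lemma Bform_evec i v : B (evec i) v = form_coef i * v (rev_ord i) 0.
Proof.
rewrite BformE (bigD1 i) //= !mxE !eqxx rmorph1 mul1r big1 ?addr0 // => j ji.
by rewrite !mxE (negPf ji) rmorph0 !mul0r.
Qed.

(** The radical is the line of the label 0 when [mu] is 0, and trivial
    otherwise; working modulo it treats both cases together. *)
Definition in_radical x := forall w, B w x = 0.

Lemma rad_coord x : (forall j, hb j -> x j 0 = 0) -> mu * x mid 0 = 0 -> in_radical x.
Proof.
move=> x_hb x_mid w; rewrite BformE (bigD1 mid) //= big1 => [|j].
  by rewrite rev_mid -mulrA /form_coef midE ltnn x_mid mulr0 addr0.
rewrite -/(hb j) => hb_j; rewrite x_hb ?mulr0 //.
by move: hb_j; rewrite !hb_neq /=; have := ltn_ord j; lia.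
Qed.

Let half u v : K := \sum_(i : idx | (i < n)%N) bar (u i 0) * v (rev_ord i) 0.

Let Bform_half u v :
  B u v = half u v + bar (u mid 0) * mu * v mid 0 + bar (half v u) * lam.
Proof.
rewrite /Bform; congr (_ + _).
rewrite (reindex_inj rev_ord_inj) /= rmorph_sum big_distrl /=.
apply: eq_big => i; first by have := ltn_ord i; lia.
by move=> _; rewrite rev_ordK rmorphM barK; ring.
Qed.

(** Modulo Delta_min, the map Q is quadratic with polarization B: the two halves
    of B contribute terms z and bar z * lam, and trading one for the other costs
    an element of Delta_min. *)
Lemma Qform_add u v : exists z,
  Q (u + v) = ((Q u).1 + (Q v).1,
     (Q u).2 + (Q v).2 - bar (Q u).1 * mu * (Q v).1 + (B u v + (z - bar z * lam))).
Proof.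
exists (half v u); rewrite Bform_half /Qform /= mxE; congr (_, _).
have -> : \sum_(i : idx | (i < n)%N) bar ((u + v) i 0) * (u + v) (rev_ord i) 0 =
          half u u + half v v + half u v + half v u.
  by rewrite -!big_split; apply: eq_bigr => i _ /=; rewrite !mxE; ring.
by rewrite -!/(half _ _); ring.
Qed.

(** The Heisenberg group is commutative modulo Delta_min, so Q(u) cancels. *)
Lemma Qform_sub u d : exists z,
  hsub F (Q (u + d)) (Q u) =
    ((Q d).1, (Q d).2 + (B u d + (z - bar z * lam))).
Proof.
have [z ->] := Qform_add u d; exists (z + bar (Q d).1 * mu * (Q u).1).
case: (Q u) (Q d) => [a b] [c y]; rewrite /hsub /hopp /hadd /=.
rewrite rmorphD !rmorphM barK; move: (mu_barE F); move: (bar mu) => m <-.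
by congr (_, _); ring.
Qed.

Lemma Qform_scale c u : Q (c *: u) = hact F (Q u) c.
Proof.
rewrite /Qform /hact /= !mxE mulrC; congr (_, _).
rewrite big_distrr big_distrl /=; apply: eq_bigr => i _.
by rewrite !mxE; ring.
Qed.

Lemma htr_Qform u : htr F (Q u) = B u u.
Proof.
by rewrite Bform_half /htr /Qform /= -/(half u u); ring.
Qed.

Definition isotropic u := Delta F (Q u).

Lemma iso_Bform u : isotropic u -> B u u = 0.
Proof. by move=> /Delta_maxP; rewrite -htr_Qform. Qed.

Lemma iso_scale c u : isotropic u -> isotropic (c *: u).
Proof. by rewrite /isotropic Qform_scale; apply: Delta_act. Qed.

Lemma iso_add u v : isotropic u -> isotropic v -> B u v = 0 -> isotropic (u + v).
Proof.
move=> iso_u iso_v uv; rewrite /isotropic; have [z ->] := Qform_add u v.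
by rewrite uv add0r; apply: (Delta_shift z (Delta_add iso_u iso_v)).
Qed.

End Form.

(** * The unitary group and Siegel transformations *)

Section Group.
Context {K : fieldType} (F : hermitianFormField K) {n : nat}.
Local Notation bar := (bar F).
Local Notation lam := (lam F).
Local Notation idx := 'I_(2 * n).+1.
Local Notation M := 'cV[K]_((2 * n).+1).
Local Notation mat := 'M[K]_((2 * n).+1).
Local Notation B := (Bform F).
Local Notation Q := (Qform F).
Local Notation G := (unitary_group F n).
Local Notation iso := (isotropic F).
Local Notation rad := (in_radical F).
Implicit Types (c d y : K) (f u v w x : M) (i j k : idx) (g s : mat).

Lemma rad_add u v : rad u -> rad v -> rad (u + v).
Proof. by move=> ru rv w; rewrite BformDr ru rv addr0. Qed.

Lemma rad_scale c u : rad u -> rad (c *: u).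
Proof. by move=> ru w; rewrite BformZr ru mulr0. Qed.

Lemma hb_rev i : hb (rev_ord i) = hb i.
Proof. by rewrite !hb_neq /=; have := ltn_ord i; lia. Qed.

Lemma eq_rev_ord i j : (rev_ord i == j) = (i == rev_ord j).
Proof. by rewrite -(inj_eq rev_ord_inj) rev_ordK. Qed.

Lemma rev_hb_neq i : hb i -> rev_ord i != i.
Proof. by rewrite hb_neq -val_eqE /=; have := ltn_ord i; lia. Qed.

Lemma Bform_evec2 i j : B (evec i) (evec j) = form_coef F i * (rev_ord i == j)%:R.
Proof. by rewrite Bform_evec mxE eqxx andbT. Qed.

Lemma iso_evec i : hb i -> iso (evec i).
Proof.
move=> hb_i; rewrite /isotropic; have -> : Q (evec i) = 0.
  rewrite /Qform mxE eqxx andbT eq_sym (negPf hb_i); congr (_, _).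
  apply: big1 => k _; rewrite !mxE !eqxx !andbT.
  have [->|_] := eqVneq k i; last by rewrite rmorph0 mul0r.
  by rewrite (negPf (rev_hb_neq hb_i)) mulr0.
by have [[]] := Delta_submod F.
Qed.

(** What is left of u sits at the label 0, where isotropy gives
    [bar b * mu * b = 0], so that either [mu] or the coordinate b vanishes. *)
Lemma rad_iso_sub u i : hb i -> iso u ->
  (forall j, hb j -> j != i -> u j 0 = 0) -> rad (u - u i 0 *: evec i).
Proof.
move=> hb_i iso_u u_hb; apply: rad_coord => [j hb_j|].
  rewrite !mxE eqxx andbT; have [->|ji] := eqVneq j i; first by rewrite mulr1 subrr.
  by rewrite (u_hb j) // mulr0 subr0.
rewrite !mxE eqxx andbT eq_sym (negPf hb_i) mulr0 subr0.
have := iso_Bform iso_u; rewrite BformE (bigD1 mid) //= rev_mid big1 => [|j].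
  rewrite addr0 /form_coef midE ltnn -mulrA => /eqP; rewrite mulf_eq0 bar_eq0.
  by case/orP => /eqP // ->; rewrite mulr0.
rewrite -/(hb j) => hb_j; have [ji|ji] := eqVneq j i.
  by rewrite (u_hb (rev_ord j)) ?mulr0 ?hb_rev // ji rev_hb_neq.
by rewrite u_hb // rmorph0 !mul0r.
Qed.

Lemma unitary_unit g : G g -> g \in unitmx.
Proof. by case. Qed.

Lemma unitary_Bform g u v : G g -> B (g *m u) (g *m v) = B u v.
Proof. by case=> _ + _; apply. Qed.

Lemma unitary_iso g u : G g -> iso u -> iso (g *m u).
Proof.
case=> _ _ /(_ u) gu iso_u; have := Delta_add gu iso_u; rewrite /isotropic.
by case: (Q u) (Q _) => [a b] [a' b']; congr Delta;
  rewrite /hsub /hopp /hadd /=; congr (_, _); ring.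
Qed.

Lemma unitary_mul g s : G g -> G s -> G (g *m s).
Proof.
move=> Gg Gs; split=> [|u v|u]; first by rewrite unitmx_mul !unitary_unit.
  by rewrite -!mulmxA !unitary_Bform.
rewrite (hsub_trans _ (Q (s *m u))) -mulmxA.
by have [_ _ gP] := Gg; have [_ _ sP] := Gs; apply: Delta_add.
Qed.

Lemma unitary_inv g : G g -> G (invmx g).
Proof.
move=> Gg; have g_unit := unitary_unit Gg; split=> [|u v|u].
- by rewrite unitmx_inv.
- by rewrite -(unitary_Bform (invmx g *m u) (invmx g *m v) Gg) !mulKVmx.
- rewrite -hopp_hsub; apply: Delta_opp.
  by have [_ _ /(_ (invmx g *m u))] := Gg; rewrite mulKVmx.
Qed.

Lemma Bform_adj g u v : G g -> B u (g *m v) = B (invmx g *m u) v.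
Proof.
by move=> Gg; rewrite -[RHS](unitary_Bform _ _ Gg) mulKVmx // unitary_unit.
Qed.

Lemma unitary_rad g x : G g -> rad x -> rad (g *m x).
Proof. by move=> Gg rx w; rewrite Bform_adj. Qed.

Lemma mx_ext (s g : mat) : (forall x : M, s *m x = g *m x) -> s = g.
Proof.
move=> sg; apply/matrixP => i j.
by have /colP/(_ i) := sg (delta_mx j 0); rewrite -!colE !mxE.
Qed.

(** The row vector of the linear form B(f, _). *)
Definition form_row f : 'rV[K]_((2 * n).+1) :=
  \row_j (bar (f (rev_ord j) 0) * form_coef F (rev_ord j)).

Lemma form_row_mul f x : form_row f *m x = (B f x)%:M.
Proof.
apply/matrixP => i j; rewrite !ord1 mxE BformE !mxE eqxx mulr1n.
rewrite (reindex_inj rev_ord_inj) /=; apply: eq_bigr => k _.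
by rewrite !mxE rev_ordK.
Qed.

(** The Siegel transformation centred at the isotropic vector f, with direction w
    orthogonal to f; the parameter y makes up for w not being isotropic. *)
Definition siegel_mx f w y : mat :=
  1%:M + w *m form_row f + f *m (y *: form_row f - lam^-1 *: form_row w).

Lemma siegelE f w y x :
  siegel_mx f w y *m x = x + B f x *: w + (y * B f x - lam^-1 * B w x) *: f.
Proof.
rewrite /siegel_mx !mulmxDl mul1mx -!mulmxA mulmxBl -!scalemxAl !form_row_mul.
by rewrite !scale_scalar_mx -raddfB !mul_mx_scalar.
Qed.

Lemma siegelD f w w' y y' : B f f = 0 -> B f w = 0 -> B f w' = 0 ->
  siegel_mx f w y *m siegel_mx f w' y' =
    siegel_mx f (w + w') (y + y' - lam^-1 * B w w').
Proof.
move=> ff fw fw'; apply: mx_ext => x; rewrite -mulmxA !siegelE.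
rewrite !BformP ff fw' (Bform_orth fw).
by apply/colP => i; rewrite !mxE; ring.
Qed.

Lemma siegel00 f : siegel_mx f 0 0 = 1%:M.
Proof.
apply: mx_ext => x; rewrite siegelE mul1mx -(scale0r 0) !BformP rmorph0.
by rewrite !scale0r scaler0 !mul0r mulr0 subrr scale0r !addr0.
Qed.

(** The condition on y says that Q(w) and (0, lam y) add up to an element of
    Delta; its trace gives B(w, w) = - (lam y + bar y), which is what B-invariance
    needs. *)
Lemma siegel_unitary f w y :
  iso f -> B f w = 0 -> Delta F (hadd F (Q w) (0, lam * y)) ->
  G (siegel_mx f w y).
Proof.
move=> iso_f fw Dwy; have ff := iso_Bform iso_f; have wf := Bform_orth fw.
have wwy : B w w = - (lam * y + bar y).
  have := Delta_maxP Dwy; rewrite /Delta_max /= htr_center htr_Qform.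
  rewrite rmorphM -mulrA [bar y * _]mulrC mulrA [bar lam * _]mulrC lam_bar mul1r.
  by move=> /eqP; rewrite -addrA addr_eq0 => /eqP.
split.
(* The inverse is the transformation with direction -w. *)
- have := @siegelD f w (- w) y (- y - lam^-1 * B w w) ff fw.
  rewrite BformNr fw oppr0 subrr => /(_ erefl).
  rewrite (_ : y + _ - _ = 0); last by rewrite BformNr; ring.
  by rewrite siegel00 => /mulmx1_unit[].
- move=> u v; rewrite !siegelE !BformP ff fw wf wwy.
  rewrite (Bform_sym F f u) (Bform_sym F w u).
  rewrite !rmorphB !rmorphM fmorphV !bar_lamV.
  by field; rewrite lam_neq0 oner_neq0.
- move=> u; set b := B f u; set c := y * b - lam^-1 * B w u.
  rewrite siegelE -addrA -/b -/c.
  have [z ->] := Qform_sub F u (b *: w + c *: f).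
  have [z' ->] := Qform_add F (b *: w) (c *: f).
  have -> : B u (b *: w + c *: f) = bar b * lam * y * b +
      (b * bar (B w u) * lam - bar (b * bar (B w u) * lam) * lam).
    rewrite !BformP (Bform_sym F f u) (Bform_sym F w u) -/b /c.
    by rewrite !rmorphM barK bar_lamV; field; exact: lam_neq0.
  rewrite !BformP wf mulr0 mulr0.
  have := Delta_add (Delta_act b Dwy) (iso_scale c iso_f).
  move=> /(Delta_shift (z + z' + b * bar (B w u) * lam)).
  rewrite !Qform_scale; congr Delta; rewrite /hadd /hact.
  case: (Q w) (Q f) => [w1 w2] [f1 f2] /=; congr (_, _); first by ring.
  by rewrite !rmorphD; ring.
Qed.

End Group.

(** * Transitivity on orthogonal pairs of isotropic vectors *)

Section Transitivity.
Context {K : fieldType} (F : hermitianFormField K) {n : nat}.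
Local Notation bar := (bar F).
Local Notation lam := (lam F).
Local Notation idx := 'I_(2 * n).+1.
Local Notation M := 'cV[K]_((2 * n).+1).
Local Notation mat := 'M[K]_((2 * n).+1).
Local Notation B := (Bform F).
Local Notation Q := (Qform F).
Local Notation G := (unitary_group F n).
Local Notation iso := (isotropic F).
Local Notation rad := (in_radical F).
Local Notation coef := (form_coef F).
Local Notation siegel := (siegel_mx F).
Implicit Types (c d y : K) (f u v w x : M) (i j k t : idx) (g s : mat).

(** Ordered bases of the totally isotropic planes that meet the radical
    trivially. *)
Definition iso_pair u v :=
  [/\ iso u, iso v, B u v = 0
    & forall c d, rad (c *: u + d *: v) -> c = 0 /\ d = 0].

Lemma siegel0_unitary f w : iso f -> iso w -> B f w = 0 -> G (siegel f w 0).
Proof.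
move=> iso_f iso_w fw; apply: siegel_unitary => //.
by move: iso_w; congr Delta; case: (Q w) => a b; rewrite /hadd /= !mulr0 !addr0 subr0.
Qed.

Lemma siegel_conj g f w y : G g ->
  g *m siegel f w y *m invmx g = siegel (g *m f) (g *m w) y.
Proof.
move=> Gg; apply: mx_ext => x; rewrite -!mulmxA !siegelE !mulmxDr -!scalemxAr.
by rewrite mulKVmx ?(unitary_unit Gg) // !(Bform_adj _ _ (unitary_inv Gg)) invmxK.
Qed.

(** The direction must be a multiple of v - u, and y is then forced by u |-> v;
    the condition on y holds because Q(v) and Q(u) lie in Delta. *)
Lemma siegel_transport f u v : iso f -> iso u -> iso v ->
    B f u != 0 -> B f u = B f v ->
  exists g, [/\ G g, g *m u = v &
    forall x, B f x = 0 -> B u x = 0 -> B v x = 0 -> g *m x = x].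
Proof.
move=> iso_f iso_u iso_v fu_neq0 fuv; set k := (B f u)^-1; set w := v - u.
have fw : B f w = 0 by rewrite /w !BformP fuv subrr.
exists (siegel f (k *: w) (lam^-1 * bar k * k * B w u)); split.
- apply: siegel_unitary => //; first by rewrite BformZr fw mulr0.
  have Dwu : Delta F (hadd F (Q w) (0, B w u)).
    have [z Qv] := Qform_add F w u; move: iso_v; rewrite /isotropic -(subrK u v) -/w Qv.
    move=> /(Delta_shift (- z)) Dv; have := Delta_add Dv (Delta_opp iso_u).
    case: (Q w) (Q u) => [a b] [a' b']; congr Delta.
    rewrite /hadd /hopp /= rmorphN rmorphD.
    by congr (_, _); ring.
  have := Delta_act k Dwu; rewrite Qform_scale; congr Delta.
  case: (Q w) => a b; rewrite /hact /hadd /=; congr (_, _); first by rewrite !addr0.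
  by field; exact: lam_neq0.
- rewrite siegelE BformZl scalerA mulfV // scale1r.
  rewrite (_ : _ * B f u - _ = 0); last first.
    by rewrite /k; field; rewrite bar_eq0 fu_neq0 lam_neq0.
  by rewrite scale0r addr0 /w addrC subrK.
- move=> x fx ux vx; rewrite siegelE !BformP fx ux vx.
  by rewrite !(mulr0, subrr, scale0r, addr0).
Qed.

(** Orthogonality to the hyperbolic plane of the labels i and -i. *)
Definition perp i x := B (evec i) x = 0 /\ B (evec (rev_ord i)) x = 0.

(** A combination f of e_-j and e_-k is isotropic and can be given product 1 with
    both vectors. *)
Lemma basis_to_basis j k c d : hb j -> hb k -> k != j -> k != rev_ord j ->
    c != 0 -> d != 0 ->
  exists g, [/\ G g, g *m (c *: evec j) = d *: evec k &
    forall x, perp j x -> perp k x -> g *m x = x].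
Proof.
move=> hb_j hb_k kj krj c0 d0.
have coef_neq0 i : hb i -> coef (rev_ord i) != 0 by rewrite -hb_rev; apply: coef_hb.
have /negPf jk : rev_ord j != k by rewrite eq_sym.
have /negPf kj' : rev_ord k != j by rewrite eq_rev_ord.
pose f := bar (c * coef (rev_ord j))^-1 *: evec (rev_ord j)
          + bar (d * coef (rev_ord k))^-1 *: evec (rev_ord k) : M.
have fj : B f (c *: evec j) = 1.
  rewrite !BformP !barK !Bform_evec2 !rev_ordK eqxx (negPf kj) !mulr0 addr0 mulr1.
  by field; rewrite c0 coef_neq0.
have fk : B f (d *: evec k) = 1.
  rewrite !BformP !barK !Bform_evec2 !rev_ordK eqxx eq_sym (negPf kj) !mulr0 add0r mulr1.
  by field; rewrite d0 coef_neq0.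
have iso_f : iso f.
  apply: iso_add; do 1?by apply: iso_scale; apply: iso_evec; rewrite hb_rev.
  by rewrite !BformP Bform_evec2 rev_ordK eq_sym kj' !mulr0.
have [||||g [Gg gj gx]] := @siegel_transport f (c *: evec j) (d *: evec k) iso_f.
- by apply: iso_scale; apply: iso_evec.
- by apply: iso_scale; apply: iso_evec.
- by rewrite fj oner_neq0.
- by rewrite fj fk.
exists g; split=> // x [jx rjx] [kx rkx]; apply: gx; rewrite !BformP.
- by rewrite rjx rkx !mulr0 addr0.
- by rewrite jx mulr0.
- by rewrite kx mulr0.
Qed.

(** First move u to a multiple of e_j using e_-j, then e_j to e_t; when j is t or
    -t, a detour through a third label k is required.  The vector x is carried
    along so that the second vector of a pair can be moved while the first one
    stays fixed. *)
Lemma isotropic_to_basis x t k j u : hb t -> hb k -> k != t -> k != rev_ord t ->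
    hb j -> u j 0 != 0 -> iso u -> B u x = 0 ->
    perp t x -> perp k x -> perp j x ->
  exists g, [/\ G g, g *m u = evec t & g *m x = x].
Proof.
move=> hb_t hb_k kt krt hb_j uj iso_u ux tx kx jx.
have [|||||g [Gg gu gx]] := @siegel_transport (evec (rev_ord j)) u (u j 0 *: evec j).
- by apply: iso_evec; rewrite hb_rev.
- by [].
- by apply: iso_scale; apply: iso_evec.
- by rewrite Bform_evec rev_ordK mulf_neq0 ?coef_hb ?hb_rev.
- by rewrite BformZr Bform_evec Bform_evec2 rev_ordK eqxx mulr1 mulrC.
have {}gx : g *m x = x.
  by apply: gx => //; [case: jx | rewrite BformZl; case: jx => -> _; rewrite mulr0].
have [jt | /norP[tj trj]] := boolP ((t == j) || (t == rev_ord j)); last first.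
  have [g' [Gg' g'j g'x]] := basis_to_basis hb_j hb_t tj trj uj (oner_neq0 K).
  exists (g' *m g); split; first exact: unitary_mul.
    by rewrite -mulmxA gu g'j scale1r.
  by rewrite -mulmxA gx g'x.
have [kj krj] : k != j /\ k != rev_ord j.
  by case/orP: jt => /eqP jt; split; move: kt krt; rewrite jt ?rev_ordK.
have [tk trk] : t != k /\ t != rev_ord k.
  by split; rewrite eq_sym // eq_rev_ord.
have [g' [Gg' g'j g'x]] := basis_to_basis hb_j hb_k kj krj uj (oner_neq0 K).
have [g2 [Gg2 g2j g2x]] := basis_to_basis hb_k hb_t tk trk (oner_neq0 K) (oner_neq0 K).
exists (g2 *m (g' *m g)); split; first by do 2?apply: unitary_mul.
  by rewrite -!mulmxA gu g'j g2j scale1r.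
by rewrite -!mulmxA gx g'x // g2x.
Qed.

Lemma iso_pair_to_basis p q r a b : hb p -> hb q -> hb r ->
    q != p -> q != rev_ord p -> r != p -> r != rev_ord p ->
    r != q -> r != rev_ord q -> iso_pair a b ->
  exists g, [/\ G g, g *m a = evec p & g *m b = evec q].
Proof.
move=> hb_p hb_q hb_r qp qrp rp rrp rq rrq [iso_a iso_b ab indep].
have perp_e i j : i != j -> i != rev_ord j -> perp i (evec j).
  move=> ij irj; rewrite /perp !Bform_evec2 rev_ordK (negPf ij).
  by rewrite eq_rev_ord (negPf irj) !mulr0.
have perp0 i : perp i 0 by rewrite /perp -(scale0r 0) !BformZr !mul0r.
have [j [hb_j aj]] : exists j, hb j /\ a j 0 != 0.
  apply/not_existsP => a0.
  have {}a0 j : hb j -> a j 0 = 0.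
    by move=> hb_j; apply/eqP/negPn/negP => aj; apply: (a0 j).
  have := rad_iso_sub hb_p iso_a (fun j hb_j _ => a0 j hb_j).
  rewrite a0 // scale0r subr0 => rad_a.
  have [] := indep 1 0; first by rewrite scale1r scale0r addr0.
  by move/eqP; rewrite oner_eq0.
have Ba0 : B a 0 = 0 by rewrite -(scale0r 0) BformZr mul0r.
have [g [Gg ga _]] := isotropic_to_basis hb_p hb_q qp qrp hb_j aj iso_a Ba0
  (perp0 p) (perp0 q) (perp0 j).
have iso_gb := unitary_iso Gg iso_b.
have gb_p : B (evec p) (g *m b) = 0 by rewrite -ga unitary_Bform.
have [i [hb_i ip irp bi]] :
    exists i, [/\ hb i, i != p, i != rev_ord p & (g *m b) i 0 != 0].
  apply/not_existsP => b0.
  have /(rad_iso_sub hb_p iso_gb) : forall i, hb i -> i != p -> (g *m b) i 0 = 0.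
    move=> i hb_i ip; have [->|irp] := eqVneq i (rev_ord p).
      move: gb_p; rewrite Bform_evec => /eqP; rewrite mulf_eq0 (negPf (coef_hb F hb_p)).
      by move/eqP.
    by apply/eqP/negPn/negP => bi; apply: (b0 i).
  rewrite -ga scalemxAr -mulmxBr => /(unitary_rad (unitary_inv Gg)).
  rewrite mulKmx ?(unitary_unit Gg) // => rad_ba.
  have [] := indep (- (g *m b) p 0) 1; first by rewrite scale1r scaleNr addrC.
  by move=> _ /eqP; rewrite oner_eq0.
have [||||g2 [Gg2 g2b g2p]] :=
  @isotropic_to_basis (evec p) q r i (g *m b) hb_q hb_r rq rrq hb_i bi iso_gb.
- exact: Bform_orth.
- exact: perp_e.
- exact: perp_e.
- exact: perp_e.
by exists (g2 *m g); rewrite -!mulmxA ga; split=> //; apply: unitary_mul.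
Qed.

Lemma three_labels : (3 <= n)%N ->
  exists p : 'I_3 -> idx, [/\ forall a, hb (p a),
    forall a b, a != b -> p a != p b & forall a b, p a != rev_ord (p b)].
Proof.
move=> n3; have ordE (a : 'I_3) : (inord a : idx) = a :> nat.
  by rewrite inordK //; have := ltn_ord a; lia.
exists (fun a => inord a); split=> [a|a b|a b].
- by rewrite hb_neq ordE; have := ltn_ord a; lia.
- by rewrite -!val_eqE /= !ordE.
- by rewrite -!val_eqE /= !ordE; have := ltn_ord a; have := ltn_ord b; lia.
Qed.

Lemma siegel_pair_conj f w f' w' : (3 <= n)%N ->
    iso_pair f w -> iso_pair f' w' ->
  exists2 g, G g & siegel f' w' 0 = g *m siegel f w 0 *m invmx g.
Proof.
move=> n3 fw fw'.
have [p [hb_p neq_p neq_rp]] := three_labels n3.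
have toP := @iso_pair_to_basis (p 0) (p 1) (p 2).
have {}toP a b : iso_pair a b ->
    exists g, [/\ G g, g *m a = evec (p 0) & g *m b = evec (p 1)].
  by apply: toP => //; apply: neq_p.
have [g [Gg gf gw]] := toP _ _ fw; have [g' [Gg' gf' gw']] := toP _ _ fw'.
exists (invmx g' *m g); first exact/unitary_mul/Gg/unitary_inv.
rewrite siegel_conj; last exact/unitary_mul/Gg/unitary_inv.
by rewrite -!mulmxA gf gw -gf' -gw' !mulKmx ?(unitary_unit Gg').
Qed.

End Transitivity.

(** * Double commutators *)

Section Commutators.
Context {K : fieldType} (F : hermitianFormField K) {n : nat}.
Local Notation bar := (bar F).
Local Notation idx := 'I_(2 * n).+1.
Local Notation M := 'cV[K]_((2 * n).+1).
Local Notation mat := 'M[K]_((2 * n).+1).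
Local Notation B := (Bform F).
Local Notation G := (unitary_group F n).
Local Notation iso := (isotropic F).
Local Notation rad := (in_radical F).
Local Notation coef := (form_coef F).
Local Notation siegel := (siegel_mx F).
Implicit Types (c d y : K) (f p q r s u v w x : M) (i j k : idx) (g : mat).

Lemma rad_eq0 c x : rad (c *: x) -> ~ rad x -> c = 0.
Proof.
move=> rcx nrx; apply/eqP/negPn/negP => c0; apply: nrx.
by rewrite -[x](scalerK c0); apply: rad_scale.
Qed.

(** If x is orthogonal to the plane <q, r>, then x is not proportional modulo
    the radical to both q and r.  Otherwise take the vector of the plane
    orthogonal to x: it is independent of x because x is not orthogonal to the
    whole plane, whereas the plane is totally isotropic. *)
Lemma iso_pair_in_plane q r x : iso_pair F q r -> iso x -> ~ rad x ->
  exists c d, iso_pair F (c *: q + d *: r) x.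
Proof.
move=> [iso_q iso_r qr indep] iso_x nrx.
have nrq : ~ rad q.
  move=> rq; have [] := indep 1 0; first by rewrite scale1r scale0r addr0.
  by move/eqP; rewrite oner_eq0.
have iso_cd c d : iso (c *: q + d *: r).
  by apply: iso_add; [exact: iso_scale|exact: iso_scale|rewrite !BformP qr !mulr0].
have [xqr|xqr] := pselect (B q x = 0 /\ B r x = 0).
  case: xqr => qx rx; have [[d rxd]|nd] := pselect (exists d, rad (x - d *: q)).
    exists 0, 1; split=> //; first by rewrite !BformP qx rx !mulr0 addr0.
    rewrite scale0r scale1r add0r => a b rab.
    have [] := indep (b * d) a.
      have := rad_add rab (rad_scale (- b) rxd); congr rad.
      by rewrite scalerBr scaleNr scalerA mulNr scaleNr opprK addrA addrK addrC.
    move=> bd0 ->; split=> //; move/eqP: bd0; rewrite mulf_eq0 => /orP[/eqP//|/eqP d0].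
    by case: nrx; move: rxd; rewrite d0 scale0r subr0.
  exists 1, 0; split=> //; first by rewrite !BformP qx rx !mulr0 addr0.
  rewrite scale0r scale1r addr0 => a b rab.
  have b0 : b = 0.
    apply/eqP/negPn/negP => b0; apply: nd; exists (- (a / b)).
    have := rad_scale b^-1 rab; congr rad.
    by rewrite scalerDr !scalerA mulVf // scale1r mulrC scaleNr opprK addrC.
  by split=> //; apply: rad_eq0 nrq; move: rab; rewrite b0 scale0r addr0.
exists (bar (B r x)), (- bar (B q x)); split=> //.
  by rewrite !BformP rmorphN !barK; ring.
move=> a b rab.
have [bq br] : b * B q x = 0 /\ b * B r x = 0.
  have := rab q; have := rab r; rewrite !BformP qr (Bform_orth qr).
  rewrite !iso_Bform // !mulr0 !addr0 !mulr0 !add0r; by [].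
have b0 : b = 0.
  apply/eqP/negPn/negP => b0; apply: xqr.
  by split; apply: (mulfI b0); rewrite ?bq ?br mulr0.
split=> //; apply/eqP/negPn/negP => a0; apply: xqr.
have [] := indep (a * bar (B r x)) (- (a * bar (B q x))).
  by move: rab; rewrite b0 scale0r addr0 scalerDr !scalerA mulrN.
move=> /eqP; rewrite mulf_eq0 (negPf a0) bar_eq0 => /eqP rx /eqP.
by rewrite oppr_eq0 mulf_eq0 (negPf a0) bar_eq0 => /eqP.
Qed.

Lemma siegel0_inv f w : iso f -> iso w -> B f w = 0 ->
  invmx (siegel f w 0) = siegel f (- w) 0.
Proof.
move=> iso_f iso_w fw; have S := siegel0_unitary iso_f iso_w fw.
apply: (can_inj (mulKmx (unitary_unit S))); rewrite mulmxV ?(unitary_unit S) //.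
rewrite siegelD ?iso_Bform // ?BformNr ?fw ?iso_Bform ?oppr0 //.
by rewrite mulr0 subrr addr0 subrr siegel00.
Qed.

Lemma commutator_siegel g f w : G g -> iso f -> iso w -> B f w = 0 ->
  commutator g (siegel f w 0) =
    siegel (g *m f) (g *m w) 0 *m siegel f (- w) 0.
Proof.
by move=> Gg iso_f iso_w fw; rewrite -siegel_conj // -siegel0_inv.
Qed.

(** The vectors u and v are meant to span a plane P of the totally isotropic
    space <s, q, p>, and s to be the vector t of P with B(t, g u) = 0 and
    B(t, g v) <> 0.  Then a = S(v, u) and b = S(r, s), where r is chosen in
    <s, q, p>: the product with g v cuts out a plane of that space, and
    [iso_pair_in_plane] finds r in this plane. *)
Lemma double_commutator g s q p u v : G g ->
    iso s -> iso q -> iso p -> B s q = 0 -> B s p = 0 -> B q p = 0 ->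
    (forall a b c, rad (a *: s + b *: q + c *: p) -> [/\ a = 0, b = 0 & c = 0]) ->
    iso u -> iso v -> B u v = 0 -> ~ rad u ->
    (forall x, x \in [:: s; q; p] -> B u x = 0 /\ B v x = 0) ->
    B s (g *m u) = 0 -> B s (g *m v) != 0 ->
  exists a b f w, [/\ G a, G b, iso_pair F f w &
    commutator (commutator g a) b = siegel f w 0].
Proof.
move=> Gg iso_s iso_q iso_p sq sp qp indep iso_u iso_v uv nru orth sx sy.
set x := g *m u in sx *; set y := g *m v in sy *.
have [us vs] := orth s (mem_head _ _).
have [|uq vq] := orth q; first by rewrite !inE eqxx orbT.
have [|up vp] := orth p; first by rewrite !inE eqxx !orbT.
have ys : B y s != 0.
  by rewrite (Bform_sym F s y) mulf_neq0 ?bar_eq0 ?lam_neq0.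
have iso_x : iso x by apply: unitary_iso.
have iso_y : iso y by apply: unitary_iso.
have nrx : ~ rad x.
  by move=> /(unitary_rad (unitary_inv Gg)); rewrite /x mulKmx ?(unitary_unit Gg).
(* Projection along s onto the vectors orthogonal to y = g v. *)
pose proj z : M := z - (B y z / B y s) *: s.
have proj_y z : B y (proj z) = 0 by rewrite !BformP divfK // subrr.
have iso_proj z : iso z -> B s z = 0 -> iso (proj z).
  move=> iso_z sz; rewrite /proj -scaleNr; apply: iso_add => //; first exact: iso_scale.
  by rewrite BformZr (Bform_orth sz) mulr0.
have qp' : iso_pair F (proj q) (proj p).
  split; try exact: iso_proj.
    by rewrite /proj !BformP (Bform_orth sq) sp qp (iso_Bform iso_s); ring.
  move=> a b rab.
  have [|_ -> ->//] := indep (- (a * (B y q / B y s) + b * (B y p / B y s))) a b.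
  move: rab; congr rad; rewrite /proj.
  by apply/colP => i; rewrite !mxE; ring.
(* The vector r of <s, q, p>, orthogonal to g u and g v and independent of g u. *)
have [c [d]] := iso_pair_in_plane qp' iso_x nrx.
set r := _ + _ => -[iso_r _ rx rx_indep].
have ry : B y r = 0 by rewrite /r BformDr !BformZr !proj_y !mulr0 addr0.
have ur : B u r = 0 by rewrite /r /proj !BformP us uq up; ring.
have vr : B v r = 0 by rewrite /r /proj !BformP vs vq vp; ring.
have rs : B r s = 0.
  by apply: Bform_orth; rewrite /r /proj !BformP sq sp (iso_Bform iso_s); ring.
have vu := Bform_orth uv.
clearbody r.
set a := siegel v u 0; set b := siegel r s 0.
have Ga : G a by apply: siegel0_unitary.
have Gb : G b by apply: siegel0_unitary.
have tau : commutator g a = siegel y x 0 *m siegel v (- u) 0.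
  exact: commutator_siegel.
have Gt : G (commutator g a).
  apply: unitary_mul (unitary_inv Ga); apply: unitary_mul (unitary_inv Gg).
  exact: unitary_mul.
have tau_r : commutator g a *m r = r.
  rewrite tau -mulmxA [siegel v _ _ *m _]siegelE vr BformNl ur.
  rewrite !(mulr0, oppr0, subr0, scale0r, addr0).
  by rewrite siegelE ry (Bform_orth rx) !(mulr0, subr0, scale0r, addr0).
have tau_s : commutator g a *m s = s + B y s *: x.
  rewrite tau -mulmxA [siegel v _ _ *m _]siegelE vs BformNl us.
  rewrite !(mulr0, oppr0, subr0, scale0r, addr0).
  by rewrite siegelE (Bform_orth sx) !(mul0r, mulr0, subr0, scale0r, addr0).
exists a, b, r, (B y s *: x); split=> //.
  split=> //; [exact: iso_scale | by rewrite BformZr rx mulr0|].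
  move=> i j; rewrite scalerA => /rx_indep[-> /eqP].
  by rewrite mulf_eq0 (negPf ys) orbF => /eqP.
rewrite commutator_siegel // tau_r tau_s siegelD ?iso_Bform //.
- rewrite !BformP (iso_Bform iso_s) (Bform_orth sx) addrAC subrr add0r.
  by congr siegel_mx; ring.
- by rewrite !BformP rs rx; ring.
- by rewrite !BformP rs; ring.
Qed.

Lemma basis_indep i j k c d y : hb i -> hb j -> hb k ->
    j != i -> k != i -> k != j ->
  rad (c *: evec i + d *: evec j + y *: evec k) -> [/\ c = 0, d = 0 & y = 0].
Proof.
move=> hb_i hb_j hb_k /negPf ji /negPf ki /negPf kj r.
have := r (evec (rev_ord i)); have := r (evec (rev_ord j)); have := r (evec (rev_ord k)).
rewrite !BformP !Bform_evec2 !rev_ordK (eq_sym i j) (eq_sym i k) (eq_sym j k).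
rewrite ji ki kj !eqxx.
rewrite !(mulr0, mulr1, add0r, addr0).
have cE (t : idx) z : hb t -> z * coef (rev_ord t) = 0 -> z = 0.
  by rewrite -hb_rev => /(coef_hb F)/negPf ct /eqP; rewrite mulf_eq0 ct orbF => /eqP.
by move=> /(cE _ _ hb_k) -> /(cE _ _ hb_j) -> /(cE _ _ hb_i) ->.
Qed.

Lemma Bform_evec2_eq0 i j : i != rev_ord j -> B (evec i) (evec j) = 0.
Proof.
by rewrite Bform_evec2 eq_rev_ord => /negPf ->; rewrite mulr0.
Qed.

(** P is the plane <e_i, e_j>, and v = e_z; subtracting a multiple of e_z from
    the other basis vector e_t makes the product of e_i and g u vanish. *)
Lemma double_commutator_basis g i j k (z t : idx) : G g ->
    hb i -> hb j -> hb k -> j != i -> j != rev_ord i ->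
    k != i -> k != rev_ord i -> k != j -> k != rev_ord j ->
    (z, t) \in [:: (i, j); (j, i)] -> B (evec i) (g *m evec z) != 0 ->
  exists a b f w, [/\ G a, G b, iso_pair F f w &
    commutator (commutator g a) b = siegel f w 0].
Proof.
move=> Gg hb_i hb_j hb_k ji jri ki kri kj krj zt iz.
pose u : M := evec t - (B (evec i) (g *m evec t) / B (evec i) (g *m evec z)) *: evec z.
have sy (a b : idx) : a != rev_ord b -> b != rev_ord a.
  by move=> ab; rewrite eq_sym eq_rev_ord.
have orth a b : a \in [:: i; j] -> b \in [:: i; j; k] -> B (evec a) (evec b) = 0.
  rewrite !inE => /orP[]/eqP-> /or3P[]/eqP->; apply: Bform_evec2_eq0 => //;
  by [rewrite eq_sym rev_hb_neq | apply: sy].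
have [z_in t_in] : z \in [:: i; j] /\ t \in [:: i; j].
  by move: zt; rewrite !inE !xpair_eqE => /orP[]/andP[/eqP-> /eqP->]; rewrite !eqxx ?orbT.
have sub (a : idx) : a \in [:: i; j] -> a \in [:: i; j; k].
  by rewrite !inE => /orP[]->; rewrite ?orbT.
have hb_z : hb z by move: z_in; rewrite !inE => /orP[]/eqP->.
have hb_t : hb t by move: t_in; rewrite !inE => /orP[]/eqP->.
have zt_neq : t != z.
  by move: zt; rewrite !inE !xpair_eqE => /orP[]/andP[/eqP-> /eqP->] //; rewrite eq_sym.
have iso_u : iso u.
  rewrite /u -scaleNr; apply: iso_add; [exact: iso_evec|exact/iso_scale/iso_evec|].
  by rewrite BformZr orth ?sub // mulr0.
apply: (@double_commutator g (evec i) (evec j) (evec k) u (evec z)) => //;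
  try exact: iso_evec.
- by apply: orth; rewrite !inE eqxx ?orbT.
- by apply: orth; rewrite !inE eqxx ?orbT.
- by apply: orth; rewrite !inE eqxx ?orbT.
- by move=> a b c; apply: basis_indep.
- by rewrite /u !BformP !orth ?sub // mulr0 subr0.
- move=> ru; have := ru (evec (rev_ord t)); rewrite /u !BformP !Bform_evec2 rev_ordK eqxx.
  rewrite (negPf zt_neq) !mulr0 subr0 mulr1 => /eqP.
  by rewrite (negPf (coef_hb F _)) ?hb_rev.
- move=> x; rewrite !inE /u => /or3P[]/eqP->;
  by rewrite !BformP !orth ?mulr0 ?subr0 // !inE eqxx ?orbT.
- by rewrite /u mulmxBr -scalemxAr !BformP divfK // subrr.
Qed.

End Commutators.

(** * Covering numbers and conjugates in unit groups *)

Section CoveringNumbers.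
Context {R : unitRingType}.
Implicit Types (X S : set R).

Lemma cn_le X S m : (0 < m)%N -> S `<=` set_power X m -> (cn X S <= m%:Z%:E)%E.
Proof.
move=> m_gt0 SXm; apply: le_infimum_Nmem; last by exists m.
have exP : exists m, `[< (0 < m)%N /\ S `<=` set_power X m >].
  by exists m; apply/asboolP.
case: (ex_minnP exP) => k /asboolP kP k_min.
exists k%:Z%:E; split; last by move=> y; apply; exists k.
by move=> _ [l lP <-]; rewrite lee_fin lez_nat k_min //; apply/asboolP.
Qed.

Lemma scn_family_le (XX : set (set R)) S m :
  (forall X, XX X -> (scn X S <= m%:Z%:E)%E) -> (scn_family XX S <= m%:Z%:E)%E.
Proof.
move=> XXm; rewrite /scn_family /supremum.
case: ifP => _; first by rewrite lee_fin.
(* If there were no supremum, the default value 0 would satisfy the bound. *)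
case: xgetP => [y _ [_ +]|_]; last by rewrite lee_fin.
by apply=> _ [X /XXm Xm <-].
Qed.

Lemma conjugateM (g h x : R) : g \is a GRing.unit -> h \is a GRing.unit ->
  conjugate g (conjugate h x) = conjugate (g * h) x.
Proof. by move=> gU hU; rewrite /conjugate invrM // !mulrA. Qed.

Lemma conjugateV (g x : R) : g \is a GRing.unit -> x \is a GRing.unit ->
  conjugate g x^-1 = (conjugate g x)^-1.
Proof.
move=> gU xU; have gxU : g * x \is a GRing.unit by rewrite unitrMr.
by rewrite /conjugate invrM ?unitrV // invrM // invrK mulrA.
Qed.

(** The second commutator contributes the inverse of the first one, whose two
    factors are again a conjugate of s and a conjugate of its inverse. *)
Lemma conj_commutators (g a b s : R) :
    g \is a GRing.unit -> a \is a GRing.unit -> b \is a GRing.unit ->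
    s \is a GRing.unit ->
  conjugate g (commutator (commutator s a) b) =
    conjugate g s * (conjugate (g * a) s)^-1
      * conjugate (g * (b * a)) s * (conjugate (g * b) s)^-1.
Proof.
move=> gU aU bU sU.
have cU x y : x \is a GRing.unit -> y \is a GRing.unit -> conjugate x y \is a GRing.unit.
  by move=> xU yU; rewrite /conjugate !unitrMr ?unitrV.
have conjM h x y : h \is a GRing.unit ->
    conjugate h (x * y) = conjugate h x * conjugate h y.
  by move=> hU; rewrite /conjugate !mulrA mulrVK.
have sVU : s^-1 \is a GRing.unit by rewrite unitrV.
have tauE : commutator s a = s * conjugate a s^-1.
  by rewrite /commutator /conjugate !mulrA.
have tauVE : (commutator s a)^-1 = conjugate a s * s^-1.
  by rewrite tauE invrM ?cU // conjugateV // invrK.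
have -> : commutator (commutator s a) b =
    commutator s a * conjugate b (commutator s a)^-1.
  by rewrite [LHS]/commutator /conjugate !mulrA.
have gaU : g * a \is a GRing.unit by rewrite unitrMr.
have gbU : g * b \is a GRing.unit by rewrite unitrMr.
rewrite conjM // tauVE tauE conjM // !conjugateM // conjM // conjugateM //.
by rewrite !conjugateV // !mulrA.
Qed.

Lemma set_power4 X (a b c d : R) : X a -> X b -> X c -> X d ->
  set_power X 4 (a * b * c * d).
Proof.
move=> Xa Xb Xc Xd; exists (fun i : 'I_4 => nth 1 [:: a; b; c; d] i).
  by move=> [[|[|[|[|]]]] //].
by rewrite !big_ord_recr big_ord0 /= mul1r.
Qed.

End CoveringNumbers.

(** * Short root transvections and classes of full level *)

Section ShortTransvections.
Context {K : fieldType} (F : hermitianFormField K) {n : nat}.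
Local Notation bar := (bar F).
Local Notation lam := (lam F).
Local Notation idx := 'I_(2 * n).+1.
Local Notation M := 'cV[K]_((2 * n).+1).
Local Notation mat := 'M[K]_((2 * n).+1).
Local Notation B := (Bform F).
Local Notation G := (unitary_group F n).
Local Notation rad := (in_radical F).
Local Notation coef := (form_coef F).
Local Notation siegel := (siegel_mx F).
Implicit Types (c d y : K) (f u v w x : M) (i j k : idx) (g s : mat).

Lemma iso_pair_evec i j c : hb i -> hb j -> i != j -> i != rev_ord j -> c != 0 ->
  iso_pair F (evec i) (c *: evec j : M).
Proof.
move=> hb_i hb_j ij irj c0; split; [exact: iso_evec | exact/iso_scale/iso_evec | |].
  by rewrite BformZr Bform_evec2_eq0 // mulr0.
move=> a b; rewrite scalerA => rab.
have := rab (evec (rev_ord i)); have := rab (evec (rev_ord j)).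
rewrite !BformP !Bform_evec2 !rev_ordK !eqxx (eq_sym j i) (negPf ij).
rewrite !(mulr0, mulr1, addr0, add0r) => /eqP bj /eqP ai.
move: ai bj; rewrite !mulf_eq0 (negPf c0) !(negPf (coef_hb F _)) ?hb_rev //.
by rewrite !orbF => /eqP-> /eqP->.
Qed.

(** Dividing c by the Gram coefficient at -j turns B(e_-j, x) into the coordinate
    x_j; the powers of lam in the definition of T_ij match the other term. *)
Lemma Tshort_siegel i j c : hb i -> hb j ->
  Tshort F i j c = siegel (evec (rev_ord j)) ((c / coef (rev_ord j)) *: evec i) 0.
Proof.
move=> hb_i hb_j; apply: mx_ext => x; rewrite siegelE.
have crj : coef (rev_ord j) != 0 by rewrite coef_hb ?hb_rev.
have deltaE (a b : idx) : delta_mx a b *m x = x b 0 *: evec a.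
  apply/colP => k; rewrite !mxE (bigD1 b) //= !mxE eqxx andbT big1 ?addr0.
    by rewrite mulrC.
  by move=> l lb; rewrite !mxE (negPf lb) andbF mul0r.
rewrite /Tshort !mulmxDl mul1mx mulNmx -!scalemxAl !deltaE !BformP !Bform_evec rev_ordK.
rewrite mul0r sub0r scaleNr !scalerA; congr (_ + _ - _ *: _).
  by congr (_ *: _); field.
rewrite mulrCA !mulrA; congr (_ * _); rewrite rmorphM fmorphV.
have -> : bar c / bar (coef (rev_ord j)) / lam =
          bar c * (bar (coef (rev_ord j)) * lam)^-1.
  by rewrite invfM mulrA.
rewrite bar_coef rev_ordK [_ ^ _ * bar c]mulrC -!mulrA; congr (_ * _).
move: hb_i hb_j; rewrite !hb_neq /epsilon /form_coef.
by case: (ltngtP i n) => //; case: (ltngtP j n) => //; rewrite ?invr1 ?mulr1 ?mul1r.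
Qed.

Lemma nontrivial_short_pair s : nontrivial_short F n s ->
  exists f w, iso_pair F f w /\ s = siegel f w 0.
Proof.
case=> s1 [i [j [c [hb_i hb_j ij irj sE]]]].
exists (evec (rev_ord j)), ((c / coef (rev_ord j)) *: evec i).
split; last by rewrite sE Tshort_siegel.
apply: iso_pair_evec; rewrite ?hb_rev // ?[rev_ord j == _]eq_sym //.
  by rewrite (inj_eq rev_ord_inj).
rewrite mulf_neq0 ?invr_eq0 ?coef_hb ?hb_rev //; apply/eqP => c0; apply: s1.
by rewrite sE /Tshort c0 rmorph0 mulr0 mul0r !scale0r addr0 subr0.
Qed.

(** The set N of the elements that map every vector g e_p, for g in G, into its
    own line modulo the radical is a subgroup.  If no element of C moved the line
    of e_p, then C, being closed under conjugation, would lie in N, and so would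
    EU; but T_qp(1) is not in N. *)
Lemma class_moves_line p q (C : set mat) : hb p -> hb q -> q != p -> q != rev_ord p ->
    classes_of_level F n setT (Delta F) C ->
  exists s, [/\ C s, G s & forall c, ~ rad (s *m evec p - c *: evec p)].
Proof.
move=> hb_p hb_q qp qrp [[s0 Gs0 CE] [_ EU_C _]].
have G1 : G 1%:M.
  by rewrite -(mulmxV (unitary_unit Gs0)); apply/unitary_mul/unitary_inv.
have GC s : C s -> G s.
  by rewrite CE => -[g Gg <-]; apply/unitary_mul/unitary_inv/Gg/unitary_mul.
apply: contrapT => noC.
have lineC s : C s -> exists c, rad (s *m evec p - c *: evec p).
  move=> Cs; apply: contrapT => nc; apply: noC; exists s.
  by split=> // [|c rc]; [exact: GC | apply: nc; exists c].
pose N : set mat := [set s | G s /\ forall g, G g ->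
  exists c, rad (s *m (g *m evec p) - c *: (g *m evec p))].
have nre g : G g -> ~ rad (g *m evec p).
  move=> Gg /(unitary_rad (unitary_inv Gg)); rewrite mulKmx ?(unitary_unit Gg) //.
  move=> /(_ (evec (rev_ord p))); rewrite Bform_evec2 rev_ordK eqxx mulr1 => /eqP.
  by rewrite (negPf (coef_hb F _)) ?hb_rev.
have N_group : msubgroup N.
  split.
  - split=> // g Gg; exists 1; rewrite mul1mx scale1r subrr => w.
    by rewrite -(scale0r 0) BformZr mul0r.
  - move=> a b [Ga aN] [Gb bN]; split=> [|g Gg]; first exact: unitary_mul.
    have [c rc] := bN _ Gg; have [d rd] := aN _ Gg; exists (c * d).
    have := rad_add (unitary_rad Ga rc) (rad_scale c rd); congr rad.
    rewrite mulmxBr scalerBr -scalemxAr scalerA addrA subrK.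
    by rewrite -[a * b]/(a *m b) -!mulmxA.
  - move=> a [Ga aN]; split=> [|g Gg]; first exact: unitary_inv.
    have [c rc] := aN _ Gg; have c0 : c != 0.
      apply/eqP => c0; move: rc; rewrite c0 scale0r subr0 mulmxA.
      exact/nre/unitary_mul.
    exists c^-1; have := rad_scale (- c^-1) (unitary_rad (unitary_inv Ga) rc).
    rewrite mulmxBr -scalemxAr mulKmx ?(unitary_unit Ga) //; congr rad.
    by rewrite scalerBr scalerA mulNr mulVf // !scaleNr scale1r opprK addrC.
have CN : C `<=` N.
  move=> s Cs; split=> [|g Gg]; first exact: GC.
  have [|c rc] := lineC (conjugate (invmx g) s).
    move: Cs; rewrite CE => -[h Gh <-]; exists (invmx g *m h).
      exact/unitary_mul/Gh/unitary_inv.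
    by rewrite conjugateM // ?unitmx_inv; apply: unitary_unit; [exact: Gg|exact: Gh].
  exists c; have := unitary_rad Gg rc; rewrite mulmxBr -scalemxAr; congr rad.
  rewrite /conjugate invrK; have -> : invmx g * s * g = invmx g *m (s *m g).
    by rewrite mulmxA.
  by rewrite -!mulmxA mulKVmx ?(unitary_unit Gg).
have : N (Tshort F q p 1).
  apply: (smallest_sub N_group CN); apply: EU_C.
  apply: sub_smallest (@subset_refl _ _) _ _; apply: sub_smallest (@subset_refl _ _) _ _.
  by left; exists q, p, 1.
case=> _ /(_ _ G1)[c].
rewrite mul1mx Tshort_siegel // siegelE => /(_ (evec (rev_ord q))).
rewrite !BformP !Bform_evec2 !rev_ordK (negPf qp) (negPf qrp) !eqxx.
have c0 i : hb i -> coef (rev_ord i) != 0 by rewrite -hb_rev; apply: coef_hb.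
rewrite !(mulr0, mulr1, add0r, addr0, subr0) mulrA mul1r mulfV ?c0 // mul1r.
by apply/eqP/c0.
Qed.

(** Some coordinate of s e_p at a label j <> p, 0 is nonzero, so e_-j is not
    orthogonal to s e_p.  If j = -p the plane <e_p, e_q> does, for any further
    label q; otherwise take <e_-j, e_p>. *)
Lemma moved_line_double_commutator (p : 'I_3 -> idx) s :
    (forall a, hb (p a)) -> (forall a b, a != b -> p a != p b) ->
    (forall a b, p a != rev_ord (p b)) ->
    G s -> (forall c, ~ rad (s *m evec (p 0) - c *: evec (p 0))) ->
  exists a b f w, [/\ G a, G b, iso_pair F f w &
    commutator (commutator s a) b = siegel f w 0].
Proof.
move=> hb_p neq_p neq_rp Gs s_line.
have [j [hb_j jp sj]] : exists j,
    [/\ hb j, j != p 0 & (s *m evec (p 0)) j 0 != 0].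
  apply/not_existsP => s0; apply: (s_line ((s *m evec (p 0)) (p 0) 0)).
  apply: rad_iso_sub => //; first by apply: unitary_iso => //; apply: iso_evec.
  by move=> j hb_j jp; apply/eqP/negPn/negP => sj; apply: (s0 j).
have {}sj : B (evec (rev_ord j)) (s *m evec (p 0)) != 0.
  by rewrite Bform_evec rev_ordK mulf_neq0 ?coef_hb ?hb_rev.
have [jE|jrp] := eqVneq j (rev_ord (p 0)).
  apply: (@double_commutator_basis _ F n s (p 0) (p 1) (p 2) (p 0) (p 1)) => //;
    try exact: neq_p; last by move: sj; rewrite jE rev_ordK.
  exact: mem_head.
(* The third label has to avoid the labels of p 0 and j up to sign. *)
pose k := if (p 1 == j) || (p 1 == rev_ord j) then p 2 else p 1.
have [kj krj] : k != j /\ k != rev_ord j.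
  rewrite /k; case: ifP => [/orP[]/eqP pj|/norP[]//].
    by rewrite -pj; split; [exact: neq_p | exact: neq_rp].
  have -> : j = rev_ord (p 1) by rewrite pj rev_ordK.
  by split; [exact: neq_rp | rewrite rev_ordK; exact: neq_p].
apply: (@double_commutator_basis _ F n s (rev_ord j) (p 0) k (p 0) (rev_ord j)) => //.
- by rewrite hb_rev.
- by rewrite /k; case: ifP.
- by rewrite eq_sym eq_rev_ord.
- by rewrite rev_ordK eq_sym.
- by rewrite rev_ordK.
- by rewrite /k; case: ifP => _; exact: neq_p.
- by rewrite /k; case: ifP => _; exact: neq_rp.
- by rewrite !inE eqxx orbT.
Qed.

Lemma short_sub_class_power4 (C : set mat) : (3 <= n)%N ->
    classes_of_level F n setT (Delta F) C ->
  nontrivial_short F n `<=` set_power (C `|` [set x^-1 | x in C]) 4.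
Proof.
move=> n3 levelC T /nontrivial_short_pair[f [w [fw ->]]].
have [p [hb_p neq_p neq_rp]] := three_labels n3.
have [s [Cs Gs s_line]] : exists s,
    [/\ C s, G s & forall c, ~ rad (s *m evec (p 0) - c *: evec (p 0))].
  by apply: (@class_moves_line (p 0) (p 1)) => //; apply: neq_p.
have [a [b [f' [w' [Ga Gb fw' comm]]]]] :=
  moved_line_double_commutator hb_p neq_p neq_rp Gs s_line.
have [g Gg ->] := siegel_pair_conj n3 fw' fw.
have -> : g *m siegel f' w' 0 *m invmx g =
          conjugate g (commutator (commutator s a) b) by rewrite comm.
have GU h : G h -> h \is a GRing.unit by apply: unitary_unit.
have Gmul h t : G h -> G t -> G (h * t) by apply: unitary_mul.
have XC h : G h -> C (conjugate h s).
  move: Cs; case: levelC => -[[s0 Gs0 ->] _] [k Gk <-] Gh.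
  by exists (h *m k); [exact: unitary_mul | rewrite conjugateM ?GU].
have XVC h : G h -> [set x^-1 | x in C] (conjugate h s)^-1.
  by move=> /XC; exists (conjugate h s).
rewrite conj_commutators ?GU //; apply: set_power4.
- by left; apply: XC.
- by right; apply/XVC/Gmul.
- by left; apply/XC/Gmul/Gmul.
- by right; apply/XVC/Gmul.
Qed.

End ShortTransvections.

Theorem theorem33 (K : fieldType) (F : hermitianFormField K) (n : nat)
    (hn : (3 <= n)%N) :
  (scn_family (classes_of_level F n setT (Delta F)) (nontrivial_short F n)
     <= 4%:E)%E.
Proof.
apply: (@scn_family_le _ _ _ 4) => C levelC.
by apply: cn_le => //; apply: short_sub_class_power4.
Qed.
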